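(* Let $n$ be a positive integer and $p,q$ distinct prime numbers with $q<p$ and $(q,n)\neq(2,2)$. Let $A_p$ be the trivial left brace of size $p$, let $A_q$ be a non-trivial left brace with cyclic multiplicative group of size $q^n$, and let $\alpha:(A_q,\circ)\to\mathrm{Aut}(A_p,+)$ be a homomorphism such that the multiplicative group of the left brace semidirect product $A_p\rtimes_\alpha A_q$ is isomorphic to a group of type c). Let $(a_1,a_2),(b_1,b_2)\in A_p\rtimes_\alpha A_q$ be elements of two (not necessarily distinct) transitive cycle bases of $A_p\rtimes_\alpha A_q$, and let $(X_1,r_1)$ and $(X_2,r_2)$ be the indecomposable solutions constructed from $(a_1,a_2)$ and $(b_1,b_2)$ respectively, using the trivial subgroup. Then $(X_1,r_1)$ and $(X_2,r_2)$ are isomorphic if and only if $a_2\equiv b_2\pmod{q^z}$, where $z=\min\{n-t,t\}$ and $q^t$ is the size of $\mathrm{Soc}(A_q)$.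
   Context: A solution is a pair $(X,r)$ with $X$ a non-empty set and $r:X\times X\to X\times X$, $r(x,y)=(\sigma_x(y),\tau_y(x))$, such that $(r\times \mathrm{id})(\mathrm{id}\times r)(r\times \mathrm{id})=(\mathrm{id}\times r)(r\times \mathrm{id})(\mathrm{id}\times r)$ on $X^3$, $r^2=\mathrm{id}$, and all maps $\sigma_x,\tau_y:X\to X$ are bijections. Two solutions $(X,r)$, $(X',r')$ are isomorphic if there is a bijection $f:X\to X'$ with $r'(f\times f)=(f\times f)r$. A solution is indecomposable if the subgroup of $\mathrm{Sym}(X)$ generated by all $\sigma_x$ acts transitively on $X$. A left brace is a set $B$ with two operations $+,\circ$ such that $(B,+)$ is an abelian group, $(B,\circ)$ is a group (the multiplicative group) and $a\circ(b+c)=a\circ b-a+a\circ c$ for all $a,b,c$. $B$ is trivial if $a\circ b=a+b$ for all $a,b$. Put $\lambda_a(b)=-a+a\circ b$; this defines an action of $(B,\circ)$ on $(B,+)$ by automorphisms. The socle is $\mathrm{Soc}(B)=\{a\in B\mid a+b=a\circ b \text{ for all } b\in B\}$. A transitive cycle base of $B$ is a subset which is a single orbit of the $\lambda$-action and generates $(B,+)$. It is known that, since $(q,n)\ne(2,2)$, a left brace $A_q$ as in the statement has cyclic additive group and is isomorphic to the left brace $C(q,n,t)$ on $(\mathbb{Z}/q^n\mathbb{Z},+)$ with $x\circ y=x+y+q^txy$ for some $t\in\{1,\dots,n-1\}$ (and then $|\mathrm{Soc}(A_q)|=q^t$); $A_q$ is identified with this left brace, which gives meaning to congruences modulo $q^z$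 in $A_q$. The semidirect product $A_p\rtimes_\alpha A_q$ is the left brace on $A_p\times A_q$ with componentwise addition and $(x_1,x_2)\circ(y_1,y_2)=(x_1\circ\alpha_{x_2}(y_1),x_2\circ y_2)$. A group of type c) (for $p,q,n$) is a group $\langle a,b\mid a^p=b^{q^n}=1,\ b^{-1}ab=a^r\rangle$ where $p,q$ are distinct primes, $r\not\equiv 1\pmod p$, $r\equiv 1\pmod q$ and $r^q\equiv 1\pmod p$. Solution constructed from an element $a$ of a transitive cycle base of a left brace $B$, using the trivial subgroup: underlying set $B$, $\sigma_x(y)=\lambda_x(a)\circ y$ and $\tau_y(x)=\sigma_{\sigma_x(y)}^{-1}(x)$ for all $x,y\in B$. *)

(* Defs.v *)
From HB Require Import structures.
From mathcomp Require Import all_boot all_order all_algebra all_fingroup all_solvable.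

Set Implicit Arguments.
Unset Strict Implicit.
Unset Printing Implicit Defensive.

Import GRing.Theory.
Local Open Scope ring_scope.

(** * Set-theoretic solutions of the Yang-Baxter equation *)

Definition pair_map (X : Type) (sigma tau : X -> X -> X) (u : X * X) : X * X :=
  (sigma u.1 u.2, tau u.2 u.1).

Definition act_left (X : Type) (r : X * X -> X * X) (u : X * X * X) :=
  (r (u.1.1, u.1.2), u.2).

Definition act_right (X : Type) (r : X * X -> X * X) (u : X * X * X) :=
  let v := r (u.1.2, u.2) in (u.1.1, v.1, v.2).

Record solution := Solution {
  sol_carrier :> Type;
  sol_sigma : sol_carrier -> sol_carrier -> sol_carrier;
  sol_tau : sol_carrier -> sol_carrier -> sol_carrier;
  sol_inhabited : inhabited sol_carrier;
  sol_braid : let r := pair_map sol_sigma sol_tau in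
    act_left r \o act_right r \o act_left r =1
    act_right r \o act_left r \o act_right r;
  sol_involutive : involutive (pair_map sol_sigma sol_tau);
  sol_sigma_bij : forall x, bijective (sol_sigma x);
  sol_tau_bij : forall y, bijective (sol_tau y)
}.

Definition sol_r (X : solution) : X * X -> X * X :=
  pair_map (@sol_sigma X) (@sol_tau X).

Definition sol_isomorphic (X Y : solution) : Prop :=
  exists2 f : X -> Y, bijective f &
    forall x y, sol_r (f x, f y) = (f (sol_r (x, y)).1, f (sol_r (x, y)).2).

(* The subgroup of Sym(X) generated by all sigma_x. *)
Inductive perm_group (X : solution) : (X -> X) -> Prop :=
  | PermGroup1 : perm_group id
  | PermGroupGen x g : perm_group g -> perm_group (sol_sigma x \o g)
  | PermGroupInv x s g : cancel s (sol_sigma x) -> cancel (sol_sigma x) s ->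
      perm_group g -> perm_group (s \o g).

Definition indecomposable (X : solution) : Prop :=
  forall x y : X, exists2 g, perm_group g & g x = y.

(** * Left braces *)

HB.mixin Record Zmodule_isLeftBrace B & GRing.Zmodule B := {
  circ : B -> B -> B;
  circ1 : B;
  circV : B -> B;
  circA : associative circ;
  circ1x : left_id circ1 circ;
  circVx : left_inverse circ1 circV circ;
  circDr : forall a b c, circ a (b + c) = circ a b - a + circ a c
}.

#[short(type="leftBraceType")]
HB.structure Definition LeftBrace :=
  { B of GRing.Zmodule B & Zmodule_isLeftBrace B }.

#[short(type="finLeftBraceType")]
HB.structure Definition FinLeftBrace :=
  { B of FinRing.Zmodule B & LeftBrace B }.

Definition trivial_brace (B : leftBraceType) : Prop :=
  forall a b : B, circ a b = a + b.

Definition lam (B : leftBraceType) (a b : B) : B := - a + circ a b.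

(* The same carrier, with (B, o) instead of (B, +) as its finite group
   structure. *)
Definition mulgroup (B : Type) : Type := B.

HB.instance Definition _ (B : finLeftBraceType) := Finite.on (mulgroup B).
HB.instance Definition _ (B : finLeftBraceType) :=
  Finite_isGroup.Build (mulgroup B) (@circA B) (@circ1x B) (@circVx B).

(* The subgroup of (V, +) generated by S: a finZmodType is a finGroupType
   under addition. *)
Definition additive_span (V : finZmodType) (S : {set V}) : {set V} := <<S>>%g.

Section FiniteBraces.

Variable B : finLeftBraceType.

Definition socle : {set B} := [set a | [forall b, a + b == circ a b]].

Definition lam_orbit (a : B) : {set B} := [set lam x a | x : B].

Definition transitive_cycle_base (S : {set B}) : Prop :=
  (exists a, S = lam_orbit a) /\ additive_span S = [set: B].

End FiniteBraces.

(** * Basic computations in a left brace *)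

Section BraceTheory.

Variable B : leftBraceType.
Implicit Types a b c x y : B.

Lemma circxV x : circ x (circV x) = circ1 :> B.
Proof.
rewrite -[LHS]circ1x -[in LHS](circVx (circV x)) -circA.
by rewrite [circ (circV x) _]circA circVx circ1x circVx.
Qed.

Lemma circx1 x : circ x circ1 = x.
Proof. by rewrite -(circVx x) circA circxV circ1x. Qed.

Lemma circKV x : cancel (circ (circV x)) (circ x).
Proof. by move=> y; rewrite circA circxV circ1x. Qed.

Lemma circK x : cancel (circ x) (circ (circV x)).
Proof. by move=> y; rewrite circA circVx circ1x. Qed.

Lemma circI x : injective (circ x).
Proof. exact: can_inj (circK x). Qed.

Lemma circ_eqV x y : circ x y = circ1 -> y = circV x.
Proof. by move=> xy1; rewrite -[y](circK x) xy1 circx1. Qed.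

Lemma circVK : involutive (@circV B).
Proof. by move=> x; apply/esym/circ_eqV; rewrite circVx. Qed.

Lemma circVM x y : circV (circ x y) = circ (circV y) (circV x).
Proof. by apply/esym/circ_eqV; rewrite -circA circKV circxV. Qed.

Lemma circx0 x : circ x 0 = x.
Proof.
have := circDr x 0 0; rewrite addr0 => /esym/eqP.
by rewrite -subr_eq0 addrK subr_eq0 => /eqP.
Qed.

Lemma circ1E : circ1 = 0 :> B.
Proof. by rewrite -(circ1x 0) circx0. Qed.

Lemma circE x y : circ x y = x + lam x y.
Proof. by rewrite /lam addrA subrr add0r. Qed.

Lemma lamD x : {morph lam x : a b / a + b}.
Proof. by move=> a b; rewrite /lam circDr !addrA. Qed.

Lemma lamM x y a : lam (circ x y) a = lam x (lam y a).
Proof.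
apply: (addrI (circ x y)); rewrite -circE -circA [circ y a]circE circE lamD.
by rewrite addrA -circE.
Qed.

Lemma lam1 a : lam circ1 a = a.
Proof. by rewrite /lam circ1x circ1E oppr0 add0r. Qed.

Lemma lamK x : cancel (lam x) (lam (circV x)).
Proof. by move=> a; rewrite -lamM circVx lam1. Qed.

Lemma lamKV x : cancel (lam (circV x)) (lam x).
Proof. by move=> a; rewrite -lamM circxV lam1. Qed.

End BraceTheory.

(** * The solution built from an element, with respect to the trivial
      subgroup *)

Section BraceSolution.

Variables (B : leftBraceType) (a : B).

Definition bs_sigma (x y : B) : B := circ (lam x a) y.

(* The inverse of the permutation bs_sigma x. *)
Definition bs_sigmaV (x y : B) : B := circ (circV (lam x a)) y.

Definition bs_tau (y x : B) : B := bs_sigmaV (bs_sigma x y) x.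

Lemma bs_sigmaK x : cancel (bs_sigma x) (bs_sigmaV x).
Proof. exact: circK. Qed.

Lemma bs_sigmaVK x : cancel (bs_sigmaV x) (bs_sigma x).
Proof. exact: circKV. Qed.

Lemma bs_inhabited : inhabited B. Proof. exact: (inhabits 0). Qed.

Lemma bs_sigma_bij x : bijective (bs_sigma x).
Proof. by exists (bs_sigmaV x); [apply: bs_sigmaK | apply: bs_sigmaVK]. Qed.

Lemma bs_involutive : involutive (pair_map bs_sigma bs_tau).
Proof.
move=> [x y]; rewrite /pair_map /bs_tau /= bs_sigmaVK.
by rewrite bs_sigmaK.
Qed.

Lemma bs_sigmaM x y z :
  bs_sigma (bs_sigma x y) (bs_sigma (bs_tau y x) z) = bs_sigma x (bs_sigma y z).
Proof.
rewrite /bs_sigma !circA; congr (circ _ z).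
set u := circ (lam x a) y; set v := bs_tau y x.
have yE : y = circ (circV (lam x a)) u by rewrite circK.
rewrite circE -lamM -/(bs_sigma u v) bs_sigmaVK.
by rewrite [RHS]circE -lamM addrC.
Qed.

Lemma bs_braid : let r := pair_map bs_sigma bs_tau in
  act_left r \o act_right r \o act_left r =1
  act_right r \o act_left r \o act_right r.
Proof.
move=> r [[x y] z]; rewrite /r /act_left /act_right /pair_map /=.
have tauE y' x' : bs_tau y' x' = bs_sigmaV (bs_sigma x' y') x' by [].
set u := bs_sigma x y; set w := bs_sigma (bs_tau y x) z.
set w' := bs_sigma y z; set v := bs_tau w' x; set Q := bs_tau w u.
have P1 : bs_sigma u w = bs_sigma x w' by apply: bs_sigmaM.
have P2 : Q = bs_sigma v (bs_tau z y).
  rewrite /Q tauE P1; apply: (can_inj (bs_sigmaK (bs_sigma x w'))).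
  by rewrite bs_sigmaVK bs_sigmaM [bs_tau z y]tauE bs_sigmaVK.
rewrite -P2 P1; congr (_, _).
rewrite tauE -/w [RHS]tauE -P2.
apply: (can_inj (bs_sigmaK w)); apply: (can_inj (bs_sigmaK u)).
rewrite bs_sigmaVK -[RHS]bs_sigmaM -/Q bs_sigmaVK P1.
by rewrite [bs_tau y x]tauE [v]tauE !bs_sigmaVK.
Qed.

Lemma bs_tauE y x :
  circV (bs_tau y x) + a = circ (circV x + a) (circ y (circV y + a)).
Proof.
have lamE z : circ (circV z) (lam z a) = circV z + a by rewrite circE lamK.
set u := circ (lam x a) y; set w := circ (circV x) u.
have wE : w = circ (circV x + a) y by rewrite /w /u circA lamE.
have -> : circV (bs_tau y x) = circ w (circV u + a).
  by rewrite circVM circVK -lamE /w -/u -circA circKV.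
have wu : circ w (circV u) = circV x by rewrite -circA circxV circx1.
have wy : circ w (circV y) = circV x + a by rewrite wE -circA circxV circx1.
rewrite circA -wE !circDr wu wy -!addrA; congr (_ + _).
by rewrite addrA [RHS]addrC.
Qed.

Lemma bs_tau_bij y : bijective (bs_tau y).
Proof.
set c := circ y (circV y + a).
pose g v := circV (circ (circV v + a) (circV c) - a).
exists g => x; rewrite /g.
  by rewrite bs_tauE -/c -circA circxV circx1 addrK circVK.
apply: (can_inj (@circVK B)); apply: (addIr a).
by rewrite bs_tauE circVK subrK -/c -circA circVx circx1.
Qed.

Definition brace_solution : solution :=
  Solution bs_inhabited bs_braid bs_involutive bs_sigma_bij bs_tau_bij.

End BraceSolution.

Lemma brace_solution_indecomposable (B : finLeftBraceType) (a : B) :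
  (exists2 S, transitive_cycle_base S & a \in S) ->
  indecomposable (brace_solution a).
Proof.
case=> S [[a0 defS] genS] aS.
pose K (h : B) := exists2 g, perm_group (X := brace_solution a) g & g =1 circ h.
have inS s : s \in S -> exists x, s = lam x a.
  move: aS; rewrite defS => /imsetP[y _ ->] /imsetP[x _ ->].
  by exists (circ x (circV y)); rewrite lamM lamK.
have K1 : K circ1 by exists id => [|x]; [apply: PermGroup1 | rewrite circ1x].
have KMs h s : K h -> s \in S -> K (circ h s).
  case=> g Hg; elim: Hg h => [|x g' _ IH|x f g' fK Kf _ IH] h gE sS.
  - case: (inS _ sS) => x ->; exists (sol_sigma (s := brace_solution a) x \o id).
      by apply: PermGroupGen; apply: PermGroup1.
    have -> : h = circ1 by rewrite -[h]circx1 -gE.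
    by move=> y; rewrite circ1x.
  - have [|g2 Hg2 g2E] := IH (circ (circV (lam x a)) h) _ sS.
      by move=> y; rewrite -circA -gE /= /bs_sigma circK.
    exists (sol_sigma (s := brace_solution a) x \o g2).
      exact: PermGroupGen.
    by move=> y; rewrite /= g2E /bs_sigma !circA circxV circ1x.
  - have fE y : f y = circ (circV (lam x a)) y.
      by apply: (can_inj Kf); rewrite fK /= /bs_sigma circKV.
    have [|g2 Hg2 g2E] := IH (circ (lam x a) h) _ sS.
      by move=> y; rewrite -circA -gE /= fE circKV.
    exists (f \o g2); first exact: PermGroupInv fK Kf Hg2.
    by move=> y; rewrite /= g2E fE -!circA circK.
have KT h : K h.
  have : h \in additive_span S by rewrite genS inE.
  case/gen_prodgP=> n [c cS ->].
  elim: n c cS => [|n IH] c cS; first by rewrite big_ord0; rewrite circ1E in K1.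
  rewrite big_ord_recr /=; set h' := bigop _ _ _.
  have Kh' : K h' by apply: IH => i; apply: cS.
  change (K (h' + c ord_max)); rewrite -[c ord_max](lamKV h') -circE.
  apply: KMs => //; move: (cS ord_max); rewrite defS => /imsetP[y _ ->].
  by rewrite -lamM; apply: imset_f.
move=> x y; have [g Hg gE] := KT (circ y (circV x)).
by exists g; rewrite // gE -circA circVx circx1.
Qed.

(** * Semidirect products *)

(* Homomorphisms from (B, o) to Aut(A, +). *)
Record add_action (B : leftBraceType) (A : zmodType) := AddAction {
  add_act :> B -> A -> A;
  add_actD : forall x, {morph add_act x : a b / a + b};
  add_act_bij : forall x, bijective (add_act x);
  add_actM : forall x y, add_act (circ x y) =1 add_act x \o add_act y
}.

(* Each alpha_x is an automorphism of the left brace A. *)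
Definition circ_compatible (B A : leftBraceType) (alpha : add_action B A) :=
  forall x, {morph alpha x : a b / circ a b}.

Lemma trivial_compatible (B A : leftBraceType) (alpha : add_action B A) :
  trivial_brace A -> circ_compatible alpha.
Proof. by move=> trivA x a b; rewrite !trivA add_actD. Qed.

Definition brace_sdprod (B A : leftBraceType) (alpha : add_action B A)
  (compat : circ_compatible alpha) : Type := (A * B)%type.

Section SemidirectProduct.

Variables (B A : leftBraceType) (alpha : add_action B A).
Hypothesis compat : circ_compatible alpha.

Local Notation T := (brace_sdprod compat).

HB.instance Definition _ := GRing.Zmodule.on T.

Definition sd_circ (u v : T) : T := (circ u.1 (alpha u.2 v.1), circ u.2 v.2).
Definition sd_circ1 : T := (circ1, circ1).
Definition sd_circV (u : T) : T :=
  (alpha (circV u.2) (circV u.1), circV u.2).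

Lemma sd_act1 : alpha circ1 =1 id.
Proof.
by move=> a; apply: (bij_inj (add_act_bij alpha circ1)); rewrite -[LHS]add_actM circ1x.
Qed.

Lemma sd_act_circ1 x : alpha x circ1 = circ1.
Proof. by apply: (@circI _ (alpha x circ1)); rewrite -compat !circx1. Qed.

Lemma sd_circA : associative sd_circ.
Proof. by move=> u v w; rewrite /sd_circ /= compat add_actM !circA. Qed.

Lemma sd_circ1x : left_id sd_circ1 sd_circ.
Proof. by case=> x y; rewrite /sd_circ /= sd_act1 !circ1x. Qed.

Lemma sd_circVx : left_inverse sd_circ1 sd_circV sd_circ.
Proof. by case=> x y; rewrite /sd_circ /= -compat !circVx sd_act_circ1. Qed.

Lemma sd_circDr u v w : sd_circ u (v + w) = sd_circ u v - u + sd_circ u w.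
Proof. by case: u v w => [? ?] [? ?] [? ?]; rewrite /sd_circ /= add_actD !circDr. Qed.

HB.instance Definition _ := Zmodule_isLeftBrace.Build T
  sd_circA sd_circ1x sd_circVx sd_circDr.

End SemidirectProduct.

HB.instance Definition _ (B A : finLeftBraceType) (alpha : add_action B A)
  (compat : circ_compatible alpha) := Finite.on (brace_sdprod compat).

(** * The left braces C(q, n, t) and congruences *)

Section CyclicBraces.

Variables (q n t : nat).

(* Multiplication of C(q, n, t), whose addition is that of 'Z_(q ^ n). *)
Definition C_circ (x y : 'Z_(q ^ n)) : 'Z_(q ^ n) := x + y + (q ^ t)%:R * x * y.

Definition C_iso (A : leftBraceType) (f : A -> 'Z_(q ^ n)) : Prop :=
  [/\ bijective f, {morph f : x y / x + y} &
      {morph f : x y / circ x y >-> C_circ x y}].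

(* Congruence modulo m in A, through an identification of A with C(q, n, t);
   C_congrP shows that the choice of the identification does not matter when
   m divides q ^ n. *)
Definition C_congr (A : leftBraceType) (m : nat) (a b : A) : Prop :=
  exists2 f, C_iso f & f a = f b %[mod m].

Lemma C_congrP (A : leftBraceType) (m : nat) (a b : A) f :
  (1 < q ^ n)%N -> (m %| q ^ n)%N -> C_iso f ->
  C_congr m a b <-> f a = f b %[mod m].
Proof.
move=> q1 mq Hf; split; last by exists f.
case=> g [gbij gD _] gab; case: Hf => [[f' fK Kf] fD _].
have [h Kh hK] := gbij.
pose k x := f (h x).
have kD : {morph k : x y / x + y}.
  by move=> x y; rewrite -fD; congr f; apply: (can_inj Kh); rewrite gD !hK.
have k0 : k 0 = 0 by apply: (addIr (k 0)); rewrite -kD !add0r.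
have kn j : k j%:R = k 1 *+ j.
  by elim: j => [|j IH]; rewrite ?mulr0n // mulrSr kD IH -mulrSr.
have kE x : (k x = k 1%R * x %[mod m])%N.
  rewrite -{1}[x]natr_Zp kn -mulr_natr natr_Zp /=.
  by rewrite modn_dvdm // Zp_cast.
have fk x : f x = k (g x) by rewrite /k Kh.
by rewrite !fk kE [RHS]kE -modnMmr gab modnMmr.
Qed.

End CyclicBraces.

(** * Groups of type c) *)

(* A residue r modulo p * q is represented by a natural number. *)
Definition type_c_group (p q n : nat) (gT : finGroupType) (G : {set gT}) :=
  [/\ prime p, prime q, p != q &
    exists r : nat, [/\ r != 1 %[mod p], r = 1 %[mod q], r ^ q = 1 %[mod p] &
      (G \isog Grp (a : b : a ^+ p, b ^+ (q ^ n), a ^ b = a ^+ r))%g]]%N.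

(* Main.v *)
Require Import Defs.
From HB Require Import structures.
From mathcomp Require Import all_boot all_order all_algebra all_fingroup all_solvable.

Set Implicit Arguments.
Unset Strict Implicit.
Unset Printing Implicit Defensive.

Import GRing.Theory FinRing.Theory.

(** Two observations reduce the corollary to arithmetic in Z/q^n.

    Isomorphisms of solutions are brace automorphisms. Write X_a for the
    solution on a left brace B with sigma_x(y) = lam_x(a) o y. Right
    translation by c is an isomorphism X_b -> X_(lam_c^-1(b)), so an isomorphism
    F : X_a -> X_b may be normalized to fix 0, with b replaced by some
    lam_c(b). Such an F satisfies F(s o y) = F(s) o F(y) for every s in the
    lam-orbit of a; as this orbit generates (B, +), hence also (B, o), F is an
    automorphism of the left brace. Thus X_a and X_b are isomorphic if and only
    if psi(a) = lam_c(b) for some automorphism psi and some c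
    ([brace_solution_isoP]).

    The brace A_q is C(q, n, t) ([cocyclic_brace_C_iso]), so its lam-action is
    lam_x(y) = (1 + q^t x) y. An automorphism of A_p x| A_q induces on A_q
    the multiplication by a unit v, and multiplicativity forces
    q^t v = q^t v^2, that is, v = 1 mod q^(n-t). Hence isomorphic solutions
    satisfy v a_2 = (1 + q^t z) b_2, which gives a_2 = b_2 modulo
    q^min(n-t,t) ([iso_congr]). Conversely, if a_2 = b_2 + q^min(n-t,t) d,
    one of the two factors suffices: v = b_2 / a_2 with z = 0 when n - t <= t,
    and v = 1 with z = d / b_2 otherwise. Multiplication by v is compatible
    with alpha because v = 1 mod q while alpha_x only depends on x mod q: in
    a group of type c) the q-th powers centralize the subgroup of order p
    ([add_act_expq], [add_act_residue]). On A_p, multiplication by a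
    suitable integer moves a_1 to any prescribed nonzero element
    ([congr_iso]).

    The identification of A_q with C(q, n, t) rests on the cyclicity of its
    additive group ([cocyclic_brace_cyclic]). If the elements killed by q
    were more than q in number, then fixed points of the q-group (A_q, o) on
    quotients would produce a left ideal of order q^2 and exponent q or, for
    q = 2 and n > 2, a left ideal of order 8 containing one of order 4 and
    exponent 2. The powers of an element w in (A_q, o) are
    w + lam_w(w) + lam_w^2(w) + ..., and lam_w is unipotent of small length on
    these left ideals; the resulting binomial formula shows that the q-th
    (respectively, the fourth) power of a generator vanishes, which contradicts
    its order. *)

(** * Isomorphisms of solutions and automorphisms of left braces *)

Section LambdaAction.

Variable B : leftBraceType.
Implicit Types a b c x y : B.
Local Open Scope ring_scope.

Lemma lam0 x : lam x 0 = 0.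
Proof. by rewrite /lam circx0 addNr. Qed.

Lemma lamMn x a k : lam x (a *+ k) = lam x a *+ k.
Proof. by elim: k => [|k IH]; rewrite ?lam0 // !mulrS lamD IH. Qed.

Lemma lam0l a : lam 0 a = a.
Proof. by rewrite -circ1E lam1. Qed.

End LambdaAction.

Section SolutionIsomorphism.

Variable B : finLeftBraceType.
Implicit Types a b c x y : B.
Local Open Scope ring_scope.

(** Since c + lam_x(a) = c o lam_(c^-1 o x)(a), this principle serves for
    additive and for multiplicative arguments alike. *)
Lemma cycle_base_ind a (P : B -> Prop) :
  (exists2 S, transitive_cycle_base S & a \in S) ->
  P 0 -> (forall c x, P c -> P (c + lam x a)) -> forall c, P c.
Proof.
case=> S [[a0 defS] genS] aS P0 PS c.
have: c \in additive_span S by rewrite genS inE.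
case/gen_prodgP=> n [s sS ->].
elim: n s sS => [|n IH] s sS; first by rewrite big_ord0.
rewrite big_ord_recr /=.
have [x ->] : exists x, s ord_max = lam x a.
  move: aS (sS ord_max); rewrite defS => /imsetP[y _ ->] /imsetP[x _ ->].
  by exists (circ x (circV y)); rewrite lamM lamK.
by apply: PS; apply: IH => i; apply: sS.
Qed.

(** A morphism of solutions is only known to respect products whose left factor
    lies in the orbit of a; generation by the orbit extends this to all
    products, and then to all sums. *)
Lemma brace_solution_isoP a b :
  (exists2 S, transitive_cycle_base S & a \in S) ->
  sol_isomorphic (brace_solution a) (brace_solution b) <->
  exists psi : B -> B, exists c, [/\ bijective psi, {morph psi : x y / x + y},
    {morph psi : x y / circ x y} & psi a = lam c b].
Proof.
move=> tcb; split; last first.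
  case=> psi [c [psi_bij psiD psiM psia]].
  have psil x y : psi (lam x y) = lam (psi x) (psi y).
    by apply: (addrI (psi x)); rewrite -psiD -!circE psiM.
  (* Right translation by c carries the solution of lam c b to that of b. *)
  pose F x := circ (psi x) c.
  have Fs x y : F (bs_sigma a x y) = bs_sigma b (F x) (F y).
    by rewrite /F /bs_sigma psiM psil psia lamM circA.
  exists F.
    case: psi_bij => phi psiK phiK; exists (fun x => phi (circ x (circV c))) => x.
      by rewrite /F -circA circxV circx1.
    by rewrite /F phiK -circA circVx circx1.
  move=> x y; rewrite /sol_r /pair_map /= -Fs; congr (_, _).
  apply: (can_inj (bs_sigmaK b (F (bs_sigma a x y)))).
  by rewrite /bs_tau -Fs bs_sigmaVK -Fs bs_sigmaVK.
case=> F Fbij Fiso.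
have Fs x y : F (circ (lam x a) y) = circ (lam (F x) b) (F y).
  by have := Fiso x y; rewrite /sol_r /pair_map /= => -[].
(* The translate of F that fixes 0. *)
pose c := F 0; pose psi x := circ (F x) (circV c).
have psi0 : psi 0 = 0 by rewrite /psi circxV circ1E.
have psis x y : psi (circ (lam x a) y) = circ (lam (psi x) (lam c b)) (psi y).
  by rewrite /psi Fs -circA -lamM -circA circVx circx1.
have psil x : psi (lam x a) = lam (psi x) (lam c b).
  by rewrite -[lam x a]circx0 psis psi0 circx0.
have psiM : {morph psi : x y / circ x y}.
  apply: (cycle_base_ind tcb) => [y|d x IH y].
    by rewrite psi0 -circ1E !circ1x.
  rewrite -[lam x a](lamKV d) -circE -lamM -circA !IH.
  by rewrite psis psil circA.
have psiDs x w : psi (x + lam w a) = psi x + psi (lam w a).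
  rewrite -{1}[lam w a](lamKV x) -circE psiM -lamM circE; congr (_ + _).
  by rewrite !psil -lamM -psiM circA circxV circ1x.
exists psi, c; split=> //.
- case: Fbij => G FK GK; exists (fun x => G (circ x c)) => x.
    by rewrite /psi -circA circVx circx1 FK.
  by rewrite /psi GK -circA circxV circx1.
- move=> x y; move: y x; apply: (cycle_base_ind tcb) => [x|y w IH x].
    by rewrite psi0 !addr0.
  by rewrite addrA !psiDs IH addrA.
- by rewrite -[a]lam1 psil circ1E psi0 -circ1E lam1.
Qed.

End SolutionIsomorphism.

(** * Subgroups stable under the additive action of a q-group *)

Lemma addr_card (V : finZmodType) (a : V) : (a *+ #|V| = 0)%R.
Proof. by rewrite -cardsT; apply: (@expg_cardG V [set: _]%G); rewrite inE. Qed.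

Section StableSubgroups.

Variables (q : nat) (V : finZmodType) (gT : finGroupType).
Variable to : {action gT &-> V}.
Implicit Types (K N L : {group V}) (a c : V) (x : gT).
Local Open Scope group_scope.
Local Open Scope ring_scope.

Hypotheses (q_pr : prime q) (qV : q.-group [set: V]) (qG : q.-group [set: gT]).
Hypothesis toD : forall x, {morph to^~ x : a c / a + c}.

Definition stable (K : {set V}) := forall x c, c \in K -> to c x \in K.

Lemma to0 x : to 0 x = 0.
Proof. by apply: (addIr (to 0 x)); rewrite -toD !add0r. Qed.

Lemma toN x a : to (- a) x = - to a x.
Proof. by apply/eqP; rewrite -addr_eq0 -toD addNr to0. Qed.

Lemma toMn x a k : to (a *+ k) x = to a x *+ k.
Proof. by elim: k => [|k IH]; rewrite ?to0 // !mulrS toD IH. Qed.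

(** The number of cosets of K in N is a positive power of q, so the q-group
    cannot fix the coset K alone. *)
Lemma fixed_coset K N : stable K -> stable N -> K \proper N ->
  exists2 a, (a \in N) && (a \notin K) & forall x, to a x - a \in K.
Proof.
move=> sK sN /properP[sKN [d dN dK]].
pose S := rcosets K N.
have lamcoset x a : (to^*)%act (K :* a)%g x = (K :* to a x)%g.
  apply/setP=> z; rewrite mem_rcoset zmodMgE zmodVgE.
  apply/imsetP/idP => [[y]|zK].
    rewrite mem_rcoset zmodMgE zmodVgE => yK ->.
    by rewrite -toN -toD sK.
  exists (to z x^-1%g); last by rewrite actKV.
  by rewrite mem_rcoset zmodMgE zmodVgE -(actK to x a) -toN -toD sK.
have actS : [acts [set: gT], on S | to^*].
  apply/actsP=> x _ C; apply/idP/idP; last first.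
    case/rcosetsP=> a aN ->; rewrite lamcoset; apply/rcosetsP.
    by exists (to a x); rewrite ?sN.
  case/rcosetsP=> a aN eC; apply/rcosetsP.
  exists (to a x^-1%g); first exact: sN.
  by rewrite -(actK (to^*)%act x C) eC lamcoset.
have qN : q.-group N by apply: pgroupS qV; apply: subsetT.
have qS : (q %| #|S|)%N.
  have: q.-nat #|S| by apply: pnat_dvd qN; apply: dvdn_indexg.
  case/p_natP=> [[|e] eS]; last by rewrite eS expnS dvdn_mulr.
  have: (N \subset K)%g by rewrite -indexg_eq1 /indexg -/S eS.
  by move/subsetP/(_ d dN); rewrite (negPf dK).
have KF : (K : {set V}) \in 'Fix_(S | to^*)([set: gT]).
  have KE : K = (K :* 0)%g :> {set V} by rewrite -zmod1gE mulg1.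
  apply/setIP; split.
    by apply/rcosetsP; exists 0; [apply: group1 | exact: KE].
  by apply/afixP=> x _; rewrite KE lamcoset to0.
have : (1 < #|'Fix_(S | to^*)([set: gT])|)%N.
  apply: leq_trans (prime_gt1 q_pr) _; apply: dvdn_leq.
    by apply/card_gt0P; exists (K : {set V}).
  by move: qS; rewrite /dvdn (pgroup_fix_mod qG actS).
rewrite (cardsD1 (K : {set V})) KF add1n ltnS => /card_gt0P[C].
rewrite in_setD1 in_setI => /and3P[CK CS CF].
case/rcosetsP: CS CK CF => a aN -> aK /afixP aF.
exists a.
  rewrite aN /=; apply: contra aK => aK; apply/eqP.
  by apply: rcoset_id.
move=> x; move/setP/(_ (to a x)): (aF x (in_setT x)).
by rewrite lamcoset rcoset_refl mem_rcoset => /esym.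
Qed.

(** One step of a central series from K towards N: a representative of a fixed
    coset is replaced by the last of its multiples by powers of q that is
    outside K, and added to K. *)
Lemma stable_step K N : stable K -> stable N -> K \proper N ->
  exists L, [/\ K \subset L, L \subset N, #|L| = (q * #|K|)%N,
    forall x c, c \in L -> to c x - c \in K & forall c, c \in L -> c *+ q \in K].
Proof.
move=> sK sN pKN; have [d /andP[dN dK] dF] := fixed_coset sK sN pKN.
have /p_natP[e eV] : q.-nat #|[set: V]| by exact: qV.
have dq : exists i, d *+ (q ^ i) \in K.
  by exists e; rewrite -eV -zmodXgE expg_cardG ?inE // -[1%g]/(0 : V) (group1 K).
case: (ex_minnP dq) => [[|i] iK imin]; first by rewrite mulr1n (negPf dK) in iK.
pose a := d *+ (q ^ i).
have aK : a \notin K by apply: contraL (ltnSn i) => /imin; rewrite -leqNgt.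
have aqK : a *+ q \in K by rewrite /a -mulrnA -expnSr.
have aN : a \in N by rewrite /a -zmodXgE groupX.
have aF x : to a x - a \in K by rewrite toMn -mulrnBl -zmodXgE groupX.
have abV (A : {set V}) : abelian A by apply: zmod_abelian.
have nK (A : {set V}) : A \subset 'N(K).
  exact: subset_trans (subsetT A) (sub_abelian_norm (abV setT) (subsetT _)).
have LP c : c \in (K <*> <[a]>)%g -> exists k j, k \in K /\ c = k + a *+ j.
  rewrite norm_joinEr ?nK // => /mulsgP[k _ kK /cycleP[j ->] ->].
  by exists k, j.
exists (K <*> <[a]>)%G; split.
- exact: joing_subl.
- by rewrite join_subG (proper_sub pKN) cycle_subG.
- have nKL : (K <| K <*> <[a]>)%g by rewrite /normal joing_subl nK.
  rewrite -(Lagrange (joing_subl K <[a]>)) -card_quotient ?nK // mulnC.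
  rewrite quotientYidl ?nK // quotient_cycle ?(subsetP (nK [set: V])) ?inE //.
  congr (_ * _)%N; apply: nt_prime_order => //.
    rewrite -morphX ?(subsetP (nK [set: V])) ?inE //.
    by apply: coset_id; rewrite zmodXgE.
  apply: contra aK => /eqP /coset_idr; apply.
  by apply: (subsetP (nK [set: V])); rewrite inE.
- move=> x c /LP[k [j [kK ->]]]; rewrite toD toMn opprD addrACA -mulrnBl.
  by rewrite groupM // ?groupM ?groupV ?sK // -zmodXgE groupX.
- move=> c /LP[k [j [kK ->]]]; rewrite mulrnDl -mulrnA mulnC mulrnA.
  by rewrite groupM // -zmodXgE groupX.
Qed.

End StableSubgroups.

(** The rank of an abelian q-group is read off from its elements of order
    dividing q. *)
Lemma cyclic_torsion q (V : finZmodType) : prime q -> (q.-group [set: V])%g ->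
  #|[set a : V | (a *+ q == 0)%R]| <= q -> cyclic [set: V].
Proof.
move=> q_pr qV le_q; have abV : abelian [set: V] := zmod_abelian _.
rewrite abelian_rank1_cyclic // (rank_pgroup qV) p_rank_abelian //.
rewrite (OhmEabelian qV) ?(abelianS (Ohm_sub _ _)) // expn1.
set A := (_ :&: _)%g.
have eA : A = [set a : V | (a *+ q == 0)%R].
  by apply/setP=> a; rewrite !inE.
rewrite eA -(leq_exp2l _ _ (prime_gt1 q_pr)) expn1.
apply: leq_trans le_q; apply: dvdn_leq; last exact: pfactor_dvdnn.
by apply/card_gt0P; exists 0%R; rewrite inE mul0rn.
Qed.

(** * Cyclicity of the additive group *)

Section CocyclicBraces.

Variable B : finLeftBraceType.
Local Open Scope group_scope.
Local Open Scope ring_scope.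
Local Notation V := (B : finZmodType).

(** The inverse turns the left action lam into a right action. *)
Definition lam_act (c : V) (x : mulgroup B) : V := lam (circV x) c.

Lemma lam_act1 : lam_act^~ 1%g =1 id.
Proof.
move=> c; rewrite /lam_act -[1%g]/(circ1 : B).
by rewrite -[circV _](circx1 (circV circ1 : B)) circVx lam1.
Qed.

Lemma lam_actM c : act_morph lam_act c.
Proof. by move=> x y; rewrite /lam_act -lamM -circVM. Qed.

Canonical lam_action := TotalAction lam_act1 lam_actM.

Lemma lam_actD x : {morph lam_action^~ x : a c / a + c}.
Proof. by move=> a c; apply: lamD. Qed.

Definition mulpow (w : B) (k : nat) : B := ((w : mulgroup B) ^+ k)%g.

Lemma mulpow0 w : mulpow w 0 = 0.
Proof. exact: circ1E. Qed.

Lemma mulpowS w k : mulpow w k.+1 = circ w (mulpow w k).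
Proof. by rewrite /mulpow expgS. Qed.

Lemma mulpowSl w k : mulpow w k.+1 = w + lam w (mulpow w k).
Proof. by rewrite mulpowS circE. Qed.

Lemma mulpowD w k l : mulpow w (k + l) = circ (mulpow w k) (mulpow w l).
Proof. by rewrite /mulpow expgD. Qed.

Lemma cyclic_mulpow : cyclic [set: mulgroup B] ->
  exists u, forall x, exists k, x = mulpow u k.
Proof.
case/cyclicP=> u defB; exists u => x.
have: (x : mulgroup B) \in <[u]>%g by rewrite -defB inE.
by case/cycleP=> k ->; exists k.
Qed.

(** A left ideal is a subgroup for both operations, and its multiplicative group
    is cyclic: some element of it has order #|L|. *)
Lemma left_ideal_generator (L : {group V}) : cyclic [set: mulgroup B] ->
  (forall x c, c \in L -> lam x c \in L) ->
  exists2 w, w \in L & forall k, mulpow w k = 0 -> (#|L| %| k)%N.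
Proof.
move=> cycB sL; pose M := [set x : mulgroup B | (x : V) \in L].
have gM : group_set M.
  apply/group_setP; split=> [|x y].
    by rewrite inE -[1%g]/(circ1 : B) circ1E; apply: (group1 L).
  rewrite !inE => xL yL; rewrite -[(x * y)%g]/(circ (x : B) y) circE.
  by apply: (groupM xL); apply: sL.
have /cyclicP[w defM] : cyclic (group gM) by apply: cyclicS cycB; apply: subsetT.
have cardM : #|M| = #|L| by apply: eq_card => x; rewrite inE.
exists (w : B) => [|k wk].
  by have := cycle_id w; rewrite -defM inE.
rewrite -cardM -[M]/(gval (group gM)) defM -orderE order_dvdn; apply/eqP.
by rewrite -[LHS]/(mulpow w k) wk -circ1E.
Qed.

(** The k-th power of w is w + lam_w(w) + ... + lam_w^(k-1)(w), here with
    lam_w unipotent of length at most 3 on w. *)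
Lemma mulpow_unipotent w c d k :
  lam w w = w + c -> lam w c = c + d -> lam w d = d ->
  mulpow w k = w *+ k + c *+ 'C(k, 2) + d *+ 'C(k, 3).
Proof.
move=> ww wc wd; elim: k => [|k IH]; first by rewrite mulpow0 !addr0.
rewrite mulpowSl IH !(lamD w) !lamMn ww wc wd !binS bin1 !mulrnDr !mulrnDl.
rewrite (mulrS w) -!addrA; do 2!congr (_ + _).
by rewrite addrCA (addrC (d *+ 'C(k, 2))).
Qed.

(** In the chain 0 < K < L (< M) of left ideals built below, each lam_x moves
    the elements of a term by elements of the preceding term, and L has
    exponent q. This makes the power of exponent q (or 4, if q = 2) of a
    generator of the largest term vanish, although its order is q^2 (or 8). A
    brace of order 4 leaves no room for M. *)
Theorem cocyclic_brace_cyclic q n : prime q -> (q, n) <> (2, 2)%N ->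
  #|B| = (q ^ n)%N -> cyclic [set: mulgroup B] -> cyclic [set: V].
Proof.
move=> q_pr qn2 cardB cycB.
have q1 := prime_gt1 q_pr.
have qV : q.-group [set: V] by rewrite /pgroup cardsT cardB pnatX pnat_id.
have qG : q.-group [set: mulgroup B].
  by rewrite /pgroup cardsT cardB pnatX pnat_id.
apply: (cyclic_torsion q_pr qV); rewrite leqNgt; apply/negP=> ltqT.
have gT : group_set ([set a : V | (a *+ q == 0)%R] : {set V}).
  apply/group_setP; split=> [|x y]; first by rewrite inE mul0rn.
  by rewrite !inE => /eqP xq /eqP yq; rewrite mulrnDl xq yq addr0.
pose T := group gT; pose step := stable_step q_pr qV qG lam_actD.
have sT : stable lam_action T.
  by move=> x c; rewrite !inE /= -lamMn => /eqP->; rewrite lam0.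
have s1 : stable lam_action (1%G : {group V}).
  by move=> x c /set1P->; apply/set1P; apply: lam0.
have sub_stable (K L : {group V}) : K \subset L ->
    (forall x c, c \in L -> lam_action c x - c \in K) -> stable lam_action L.
  move=> sKL KL x c cL; rewrite -(subrK c (lam_action c x)).
  exact: (groupM (subsetP sKL _ (KL _ _ cL)) cL).
have lamV x c : lam_action c (circV x) = lam x c by rewrite /= /lam_act circVK.
have p1T : (1%G : {group V}) \proper T.
  rewrite properEcard sub1G cards1; apply: ltn_trans ltqT; exact: q1.
have [K [_ KT cardK FK _]] := step _ _ s1 sT p1T.
rewrite cards1 muln1 in cardK.
have sK := sub_stable _ _ (sub1G K) FK.
have pKT : K \proper T by rewrite properEcard KT cardK.
have [L [KL LT cardL FL _]] := step _ _ sK sT pKT.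
rewrite cardK in cardL.
have sL := sub_stable _ _ KL FL.
have {}FK x c : c \in K -> lam x c = c.
  by move/(FK (circV x)); rewrite lamV => /set1P /eqP; rewrite subr_eq0 => /eqP.
have {}FL x c : c \in L -> lam x c - c \in K.
  by move/(FL (circV x)); rewrite lamV.
have Lq c : c \in L -> c *+ q = 0 by move/(subsetP LT); rewrite inE => /eqP.
have [q2|q2] := eqVneq q 2%N; last first.
  have [|w wL wP] := left_ideal_generator cycB (L := L).
    by move=> x c /(sL (circV x)); rewrite lamV.
  have wq : mulpow w q = 0.
    rewrite (@mulpow_unipotent w (lam w w - w) 0) ?subrKC ?lam0 //; last first.
      by rewrite addr0; apply/FK/FL.
    rewrite Lq // add0r mul0rn addr0; have/dvdnP[j ->] : (q %| 'C(q, 2))%N.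
      by apply: prime_dvd_bin; rewrite // [(2 < q)%N]ltn_neqAle eq_sym q2.
    by rewrite mulnC mulrnA Lq ?mul0rn //; apply: (subsetP KL); apply: FL.
  by move/wP: wq; rewrite cardL gtnNdvd ?prime_gt0 // ltn_Pmull // prime_gt0.
have pLV : L \proper [set: V].
  rewrite properEcard subsetT cardL cardsT cardB q2 (@ltn_exp2l 2 2 n) //.
  have: (2 ^ 2 <= 2 ^ n)%N.
    by rewrite -q2 -cardB (leq_trans _ (max_card (mem L))) // cardL q2.
  rewrite leq_exp2l // leq_eqVlt => /orP[/eqP n2|//].
  by case: qn2; rewrite q2 -n2.
have [|M [LM _ cardM FM Mq]] := step L [set: V]%G sL _ pLV.
  by move=> x c; rewrite !inE.
have sM := sub_stable _ _ LM FM.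
have [|w wM wP] := left_ideal_generator cycB (L := M).
  by move=> x c /(sM (circV x)); rewrite lamV.
have {}FM x c : c \in M -> lam x c - c \in L.
  by move/(FM (circV x)); rewrite lamV.
pose c := lam w w - w; pose d := lam w c - c.
have cL : c \in L by apply: FM.
have dK : d \in K by apply: FL.
have : mulpow w (2 * 2) = 0.
  rewrite (@mulpow_unipotent w c d) ?subrKC //; last exact: FK.
  (* 2 c = 2 d = 0, and 4 w = 0 because 2 w lies in L. *)
  rewrite -['C(_, 2)]/(2 * 3)%N -['C(_, 3)]/(2 * 2)%N !mulrnA.
  have := Lq _ cL; have := Lq d (subsetP KL _ dK); have := Lq _ (Mq _ wM).
  by rewrite q2 => -> -> ->; rewrite !mul0rn !addr0.
by move/wP; rewrite cardM cardL q2.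
Qed.

End CocyclicBraces.

(** * Identification with C(q, n, t) *)

Section CyclicBraceClassification.

Local Open Scope ring_scope.

Lemma eq_natZ N i j : (1 < N)%N ->
  (i%:R == j%:R :> 'Z_N) = (i == j %[mod N])%N.
Proof. by move=> N1; rewrite -val_eqE /= !val_Zp_nat. Qed.

Variables (B : finLeftBraceType) (q n t : nat).
Hypotheses (q_pr : prime q) (n_gt0 : (0 < n)%N) (cardB : #|B| = (q ^ n)%N).

Let N1 : (1 < q ^ n)%N.
Proof. by rewrite -(expn0 q) ltn_exp2l // prime_gt1. Qed.

(** Every lam_x is a multiplication by an integer, the additive group being
    cyclic. If lam_u is the multiplication by 1 + e, then the k-th power of u
    is u *+ j with j = ((1 + e)^k - 1) / e, and its lam is the
    multiplication by (1 + e)^k = 1 + e j. *)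
Lemma lam_generator : cyclic [set: (B : finZmodType)] ->
  cyclic [set: mulgroup B] ->
  exists (u : B) e, (0 < e)%N /\ forall x : B, exists2 j, x = u *+ j &
     forall a, lam x a = a + a *+ (e * j).
Proof.
case/cyclicP=> g defV /cyclic_mulpow[u uP]; exists u.
have gP (x : B) : exists j, x = g *+ j.
  have: x \in <[g : (B : finZmodType)]>%g by rewrite -defV inE.
  by case/cycleP=> j ->; exists j.
have [m lamg] := gP (lam u g).
have lamu (a : B) : lam u a = a *+ m.
  by have [j ->] := gP a; rewrite lamMn lamg mulrnAC.
(* Adding 2 q^n to m keeps its action and makes e positive. *)
exists (m + (q ^ n).*2).-1; set e := _.-1.
have eE : e.+1 = (m + (q ^ n).*2)%N.
  by rewrite prednK // addn_gt0 double_gt0 (ltnW N1) orbT.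
split=> [|x].
  by rewrite -ltnS eE (leq_trans N1) // -addnn addnA leq_addl.
have{} lamu (a : B) : lam u a = a + a *+ e.
  by rewrite -mulrS eE mulrnDr -muln2 mulrnA -cardB addr_card mul0rn addr0.
have [k ->] := uP x; elim: k => [|k [j jE lamj]].
  by exists 0%N => [|a]; rewrite mulpow0 // lam0l muln0 addr0.
exists (1 + j * (1 + e))%N => [|a].
  by rewrite mulpowSl lamu jE -mulrS -mulrnA mulrnDr mulr1n add1n.
rewrite mulpowS lamM lamj lamu -!mulrS -!mulrnA; congr (a *+ _).
by rewrite !add1n mulSn (mulnS e) mulnA addSn.
Qed.

(** In the notation of [lam_generator], x o y = x + y + e x y in the coordinate j.
    If e = v q^s with v prime to q, the coordinate v j turns this into
    x + y + q^s x y, and the socle, on which q^s x = 0, has order q^s. *)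
Lemma cocyclic_brace_C_iso : (q, n) <> (2, 2)%N -> cyclic [set: mulgroup B] ->
  ~ trivial_brace B -> #|socle B| = (q ^ t)%N ->
  (t < n)%N /\ exists f, @C_iso q n t B f.
Proof.
move=> qn2 cycB ntB cardS.
have cycV := cocyclic_brace_cyclic q_pr qn2 cardB cycB.
have q1 := prime_gt1 q_pr.
have [u [e [e_gt0 uP]]] := lam_generator cycV cycB.
have natu i j : (u *+ i == u *+ j) = (i == j %[mod q ^ n])%N.
  pose V : finZmodType := B.
  have <- : #[u : V]%g = (q ^ n)%N.
    rewrite orderE -cardB -cardsT; congr #|pred_of_set _|; apply/setP=> x.
    by rewrite inE; have [k -> _] := uP x; rewrite -zmodXgE mem_cycle.
  by rewrite -(@eq_expg_mod_order V u).
have logP x : exists j, x == u *+ j by have [j /eqP xj _] := uP x; exists j.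
pose log x := xchoose (logP x).
have logK x : u *+ log x = x by apply/esym/eqP/(xchooseP (logP x)).
have circu i j : circ (u *+ i) (u *+ j) = u *+ (i + j + e * (i * j)).
  rewrite circE; have [k uk ->] := uP (u *+ i).
  rewrite addrA -mulrnDr -mulrnA [RHS]mulrnDr; congr (_ + _).
  rewrite mulnC -mulnA !mulrnA [_ *+ k]mulrnAC -uk.
  by rewrite -!mulrnA mulnC mulnAC -mulnA.
have [v qv eE] := pfactor_coprime q_pr e_gt0; set s := logn q e in eE.
have sock i : (u *+ i \in socle B) = (q ^ n %| q ^ s * i)%N.
  have -> : (q ^ n %| q ^ s * i)%N = (q ^ n %| e * i)%N.
    by rewrite eE -mulnA (@Gauss_dvdr _ v) ?coprimeXl.
  rewrite inE; apply/forallP/idP => [/(_ u)|dv x].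
    rewrite -[u in _ + u]mulr1n -[u in circ _ u]mulr1n circu -mulrnDr natu muln1.
    by rewrite -[X in (X == _ %[mod _])%N]addn0 eqn_modDl mod0n eq_sym.
  rewrite -(logK x) circu -mulrnDr natu -[X in (X == _ %[mod _])%N]addn0.
  by rewrite eqn_modDl mod0n eq_sym mulnA; apply: dvdn_mulr.
have ltsn : (s < n)%N.
  rewrite ltnNge; apply/negP=> les; apply: ntB => x y.
  rewrite -(logK x); apply/esym/eqP; move: y; apply/forallP.
  have : u *+ log x \in socle B by rewrite sock dvdn_mulr // dvdn_exp2l.
  by rewrite inE.
have st : t = s.
  apply/eqP; rewrite -(eqn_exp2l _ _ q1) -cardS; apply/eqP.
  have injh : injective (fun i : 'I_(q ^ s) => u *+ (q ^ (n - s) * i)).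
    move=> i j /eqP; rewrite natu; have qs : (q ^ n = q ^ (n - s) * q ^ s)%N.
      by rewrite -expnD subnK // ltnW.
    rewrite !modn_small ?qs ?ltn_pmul2l ?expn_gt0 ?prime_gt0 //.
    by rewrite eqn_pmul2l ?expn_gt0 ?prime_gt0 // => /eqP /val_inj.
  rewrite -[RHS]card_ord -(card_imset _ injh); apply: eq_card => x.
  rewrite -[x]logK sock; have qs : (q ^ n = q ^ s * q ^ (n - s))%N.
    by rewrite -expnD subnKC // ltnW.
  rewrite qs dvdn_pmul2l ?expn_gt0 ?prime_gt0 //.
  apply/idP/imsetP => [/dvdnP[i iE]|[i _ /eqP]].
    have im : (i %% q ^ s < q ^ s)%N by rewrite ltn_mod expn_gt0 prime_gt0.
    exists (Ordinal im) => //=; apply/eqP; rewrite natu iE mulnC.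
    by rewrite qs [(q ^ s * _)%N]mulnC -!muln_modr modn_mod.
  rewrite natu qs => /eqP eij.
  have := dvdn_mull (q ^ s) (dvdnn (q ^ (n - s))) => dqs.
  by rewrite /dvdn -(modn_dvdm _ dqs) eij modn_dvdm // modnMr.
rewrite st; split=> //; exists (fun x => (v * log x)%:R).
have fu i : (v * log (u *+ i))%:R = (v * i)%:R :> 'Z_(q ^ n).
  apply/eqP; rewrite eq_natZ // -modnMmr; apply/eqP; rewrite -[RHS]modnMmr.
  congr (v * _ %% _)%N.
  by apply/eqP; rewrite -natu logK.
split.
- apply: inj_card_bij => [x y|]; last by rewrite cardB card_ord Zp_cast.
  rewrite !natrM => /mulrI eqxy; rewrite -[x]logK -[y]logK.
  apply/eqP; rewrite natu -eq_natZ //; apply/eqP; apply: eqxy.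
  by rewrite unitZpE // coprimeXl.
- by move=> x y; rewrite -[x]logK -[y]logK -mulrnDr !fu mulnDr natrD.
- move=> x y; rewrite -[x]logK -[y]logK circu !fu /C_circ -!natrM -!natrD.
  congr _%:R; rewrite eE !mulnDr; congr (_ + _)%N.
  by rewrite -!mulnA (mulnCA (log x) v) !(mulnCA (q ^ s)%N).
Qed.

End CyclicBraceClassification.

(** * Groups of type c) and the action alpha *)

Section TypeC.

Local Open Scope group_scope.

(** The subgroup generated by a is the normal Sylow p-subgroup, so it contains
    x; every element of G acts on it as a power of b, hence by an exponent
    r^j, and r^q = 1 mod p. *)
Lemma type_c_expq_commute p q n (gT : finGroupType) (G : {group gT}) :
  type_c_group p q n G -> #|G| = (p * q ^ n)%N ->
  forall g x, g \in G -> x \in G -> x ^+ p = 1 -> commute (g ^+ q) x.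
Proof.
case=> p_pr q_pr pq [r [_ _ rq]] /isoGrp_hom/existsP[[a b]] /=.
case/eqP=> defG ap bq ab cardG g x gG xG xp.
have nab : b \in 'N(<[a]>) by rewrite -cycle_subG norms_cycle ab mem_cycle.
have qn0 : (0 < q ^ n)%N by rewrite expn_gt0 prime_gt0.
rewrite norm_joinEr ?cycle_subG // in defG.
have oa : #[a] = p.
  apply/prime_nt_dvdP; rewrite ?order_dvdn ?ap //; apply/eqP=> oa.
  have := mul_cardG <[a]> <[b]>; rewrite defG cardG -!orderE oa mul1n => ob.
  have: (#[b] <= q ^ n)%N by apply: dvdn_leq; rewrite // order_dvdn bq.
  rewrite ob leqNgt (leq_trans _ (leq_pmulr _ (cardG_gt0 _))) //.
  by rewrite ltn_Pmull // prime_gt1.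
have sAG : <[a]> \subset G by rewrite -defG mulG_subl.
have nAG : <[a]> <| G.
  by rewrite /normal sAG -defG mul_subG ?normG ?cycle_subG.
have xa : x \in <[a]>.
  rewrite (mem_normal_Hall (pi := p) _ nAG xG).
    by rewrite /p_elt (pnat_dvd (n := p)) ?pnat_id // order_dvdn xp.
  rewrite /pHall sAG /pgroup -orderE oa pnat_id //=.
  rewrite -divgS // cardG -orderE oa mulKn ?prime_gt0 // pnatX pnatE //.
  by rewrite !inE eq_sym pq.
have xb : x ^ b = x ^+ r.
  by case/cycleP: xa => k ->; rewrite conjXg ab -!expgM mulnC.
move: gG; rewrite -defG => /mulsgP[_ _ /cycleP[i ->] /cycleP[j ->] ->].
have xbj m : x ^ (b ^+ m) = x ^+ (r ^ m).
  elim: m => [|m IH]; first by rewrite conjg1.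
  by rewrite expgSr conjgM IH conjXg xb -expgM -expnS.
have xg m : x ^ ((a ^+ i * b ^+ j) ^+ m) = x ^+ (r ^ (j * m)).
  elim: m => [|m IH]; first by rewrite muln0 conjg1.
  rewrite expgSr conjgM IH conjXg conjgM.
  have -> : x ^ (a ^+ i) = x.
    by case/cycleP: xa => k ->; apply/conjg_fixP/commgP/commuteX2.
  by rewrite xbj -expgM mulnS expnD.
apply/commute_sym/commgP/conjg_fixP; rewrite xg mulnC expnM.
rewrite -(expg_mod _ xp) -modnXm rq modnXm exp1n expg_mod //.
Qed.

End TypeC.

Section SemidirectTypeC.

Variables (p q n : nat) (Ap Aq : finLeftBraceType).
Variables (alpha : add_action Aq Ap) (trivAp : trivial_brace Ap).
Local Notation T := (brace_sdprod (trivial_compatible alpha trivAp)).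
Local Open Scope ring_scope.

Lemma add_act0 y : alpha y 0 = 0.
Proof. by apply: (addIr (alpha y 0)); rewrite -add_actD !add0r. Qed.

Lemma add_act0l x : alpha 0 x = x.
Proof. by rewrite -circ1E sd_act1. Qed.

(** Conjugation by (0, y) acts on A_p x 0 through alpha_y. *)
Lemma add_act_expq : #|Ap| = p -> #|Aq| = (q ^ n)%N ->
  type_c_group p q n [set: mulgroup T] ->
  forall y x, alpha (mulpow y q) x = x.
Proof.
move=> cardAp cardAq typeT y x.
have cardT : #|[set: mulgroup T]| = (p * q ^ n)%N.
  by rewrite cardsT -cardAp -cardAq -card_prod.
pose g : T := (0, y); pose h : T := (x, 0).
have gk k : mulpow g k = (0, mulpow y k) :> T.
  elim: k => [|k IH]; first by rewrite !mulpow0.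
  rewrite !mulpowS IH; congr (_, _); rewrite /= trivAp add0r.
  exact: add_act0.
have hk k : mulpow h k = (x *+ k, 0) :> T.
  elim: k => [|k IH]; first by rewrite !mulpow0.
  rewrite !mulpowS IH mulrS; congr (_, _); last by rewrite /= -circ1E circ1x.
  by rewrite /= trivAp add_act0l.
have hp : ((h : mulgroup T) ^+ p)%g = 1%g.
  rewrite -[LHS]/(mulpow h p) hk -cardAp.
  by rewrite addr_card -[1%g]/(circ1 : T) circ1E.
have := type_c_expq_commute typeT cardT (in_setT (g : mulgroup T))
  (in_setT (h : mulgroup T)) hp.
rewrite /commute -[((g : mulgroup T) ^+ q)%g]/(mulpow g q) gk => /(congr1 fst).
by rewrite /= !trivAp add0r add_act0 addr0.
Qed.

End SemidirectTypeC.

(** * Arithmetic in C(q, n, t) *)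

Section ZmodCongruences.

Variables (N d : nat).
Hypotheses (N1 : (1 < N)%N) (dN : (d %| N)%N).
Implicit Types x y : 'Z_N.
Local Open Scope ring_scope.

Lemma Zp_modD x y : (x + y)%R = (x + y)%N %[mod d].
Proof.
rewrite -[RHS](modn_dvdm _ dN); congr (modn _ d).
by congr (modn _ _); apply: Zp_cast.
Qed.

Lemma Zp_modM x y : (x * y)%R = (x * y)%N %[mod d].
Proof.
rewrite -[RHS](modn_dvdm _ dN); congr (modn _ d).
by congr (modn _ _); apply: Zp_cast.
Qed.

Lemma Zp_mod_nat k : (k%:R : 'Z_N) = k %[mod d].
Proof. by rewrite val_Zp_nat // modn_dvdm. Qed.

Lemma Zp_eqmodP x y : x = y %[mod d] <-> exists c : 'Z_N, x = y + d%:R * c.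
Proof.
split=> [xy|[c ->]].
  have: (d %| (x - y)%R)%N.
    have: (y + (x - y)%R)%N = (y + 0)%N %[mod d].
      by rewrite -Zp_modD addrC subrK addn0.
    by move/eqP; rewrite eqn_modDl mod0n.
  case/dvdnP=> c cE; exists c%:R.
  by rewrite -natrM mulnC -cE natr_Zp addrC subrK.
rewrite Zp_modD -modnDmr Zp_modM -modnMml Zp_mod_nat modnn mul0n mod0n.
by rewrite addn0.
Qed.

End ZmodCongruences.

Lemma prime_unitZ q n (x : 'Z_(q ^ n)) : prime q -> 0 < n ->
  ~~ (q %| x) -> (x \is a GRing.unit)%R.
Proof.
move=> q_pr n_gt0 qx; rewrite -[x]natr_Zp unitZpE; last first.
  by rewrite -(expn0 q) ltn_exp2l // prime_gt1.
by rewrite coprimeXl // prime_coprime.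
Qed.

Lemma Zp_annihilator q n t (x : 'Z_(q ^ n)) : prime q -> 0 < n -> t <= n ->
  ((q ^ t)%:R * x = 0)%R -> exists c : 'Z_(q ^ n), (x = (q ^ (n - t))%:R * c)%R.
Proof.
move=> q_pr n_gt0 le_tn; have N1 : 1 < q ^ n.
  by rewrite -(expn0 q) ltn_exp2l // prime_gt1.
rewrite -{1}[x]natr_Zp -natrM => /eqP.
rewrite -[X in (_ == X)%R]/(0%:R)%R eq_natZ // mod0n.
have qE : q ^ n = q ^ t * q ^ (n - t) by rewrite -expnD subnKC.
move=> dvd_x; have: q ^ t * q ^ (n - t) %| q ^ t * x by rewrite -qE.
rewrite dvdn_pmul2l ?expn_gt0 ?prime_gt0 // => /dvdnP[c xE].
by exists c%:R%R; rewrite -natrM mulnC -xE natr_Zp.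
Qed.

Section CyclicBrace.

Variables (q n t : nat) (A : finLeftBraceType) (f : A -> 'Z_(q ^ n)).
Hypotheses (q_pr : prime q) (n_gt0 : 0 < n) (fC : C_iso t f).
Local Open Scope ring_scope.

Let N1 : (1 < q ^ n)%N.
Proof. by rewrite -(expn0 q) ltn_exp2l // prime_gt1. Qed.

Lemma C_iso_bij : bijective f. Proof. by case: fC. Qed.
Lemma C_isoD : {morph f : x y / x + y}. Proof. by case: fC. Qed.
Lemma C_isoM : {morph f : x y / circ x y >-> C_circ t x y}.
Proof. by case: fC. Qed.

Lemma C_iso0 : f 0 = 0.
Proof. by apply: (addIr (f 0)); rewrite -C_isoD !add0r. Qed.

Lemma C_isoMn x k : f (x *+ k) = f x *+ k.
Proof. by elim: k => [|k IH]; rewrite ?C_iso0 // !mulrS C_isoD IH. Qed.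

Lemma C_iso_lam x y : f (lam x y) = (1 + (q ^ t)%:R * f x) * f y.
Proof.
apply: (addrI (f x)); rewrite -C_isoD -circE C_isoM /C_circ.
by rewrite mulrDl mul1r addrA.
Qed.

(** For t = 0 the element -1 would absorb under o, which is a group law. *)
Lemma C_iso_t_gt0 : (0 < t)%N.
Proof.
rewrite lt0n; apply/eqP=> t0; have [h fK hK] := C_iso_bij.
have /circI: circ (h (-1)) (h 1) = circ (h (-1)) 0.
  apply: (can_inj fK); rewrite !C_isoM /C_circ t0 !hK C_iso0.
  by rewrite !mulr0 !addr0 mul1r mulr1 addrK.
move/(congr1 f); rewrite hK C_iso0 => /eqP.
by rewrite -[1]/(1%:R) -[0]/(0%:R) eq_natZ // mod0n modn_small.
Qed.

Lemma C_iso_mulpow u k : f (mulpow u k) = (k * f u)%N %[mod q].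
Proof.
have qN : (q %| q ^ n)%N by apply: dvdn_exp.
elim: k => [|k IH]; first by rewrite mulpow0 C_iso0.
rewrite mulpowS C_isoM /C_circ Zp_modD // -modnDmr -mulrA Zp_modM // -modnMml.
rewrite Zp_mod_nat // modnMml -modnMml.
have /eqP-> : (q %| q ^ t)%N by apply: dvdn_exp => //; apply: C_iso_t_gt0.
by rewrite mul0n mod0n addn0 Zp_modD // -modnDmr IH modnDmr mulSn.
Qed.

(** Modulo q, where o is the addition because t > 0, a multiplicative generator
    u has an invertible coordinate; so the residue of the k-th power of u
    determines k mod q. *)
Lemma add_act_residue (V : zmodType) (alpha : add_action A V) :
  cyclic [set: mulgroup A] -> (forall y x, alpha (mulpow y q) x = x) ->
  forall x y, f x = f y %[mod q] -> alpha x =1 alpha y.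
Proof.
case/cyclic_mulpow=> u uP alphaq.
have alpha_mod k v : alpha (mulpow u k) v = alpha (mulpow u (k %% q)) v.
  rewrite {1}(divn_eq k q) mulpowD add_actM /=.
  by rewrite {1}/mulpow expgM; apply: alphaq.
have [h fK hK] := C_iso_bij.
have [m mE] := uP (h 1).
have m1 : (m * f u = 1 %[mod q])%N.
  by rewrite -C_iso_mulpow -mE hK -(Zp_mod_nat N1 (d := q)) // dvdn_exp.
move=> x y; have [k ->] := uP x; have [l ->] := uP y.
rewrite !C_iso_mulpow => kl v; rewrite alpha_mod [RHS]alpha_mod.
congr (alpha (mulpow u _) v).
have inv i : i = (m * (i * f u))%N %[mod q].
  by rewrite mulnCA -modnMmr m1 modnMmr muln1.
by rewrite inv [RHS]inv -modnMmr kl modnMmr.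
Qed.

End CyclicBrace.

Lemma prime_order_multiple p (V : finZmodType) (a b : V) :
  prime p -> #|V| = p -> (a != 0 -> b != 0 ->
  exists j k, a *+ j = b /\ forall x : V, x *+ j *+ k = x)%R.
Proof.
move=> p_pr cardV.
have gen (c d : V) : (c != 0 -> exists j, d = c *+ j)%R.
  move=> c0; have oc : #[c]%g = p.
    apply: nt_prime_order => //.
    by rewrite -cardV zmodXgE addr_card.
  have: d \in <[c]>%g.
    suff -> : <[c]>%g = [set: V] by rewrite inE.
    by apply/eqP; rewrite eqEcard subsetT cardsT cardV -oc leqnn.
  by case/cycleP=> j ->; exists j.
move=> a0 b0; have [j ab] := gen a b a0; have [k ba] := gen b a b0.
exists j, k; split=> // x; have [l ->] := gen a x a0.
by rewrite -!mulrnA mulnC !mulrnA -ab -ba.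
Qed.

(** * Automorphisms of the semidirect product *)

Section SemidirectIsomorphism.

Variables (n p q t : nat) (Ap Aq : finLeftBraceType).
Variables (alpha : add_action Aq Ap) (trivAp : trivial_brace Ap).
Local Notation T := (brace_sdprod (trivial_compatible alpha trivAp)).
Variable f : Aq -> 'Z_(q ^ n).
Hypotheses (p_pr : prime p) (q_pr : prime q) (neq_pq : p <> q).
Hypotheses (n_gt0 : 0 < n) (lt_tn : t < n).
Hypotheses (cardAp : #|Ap| = p) (fC : C_iso t f).
Local Open Scope ring_scope.
Implicit Types a b : T.

Let N1 : (1 < q ^ n)%N.
Proof. by rewrite -(expn0 q) ltn_exp2l // prime_gt1. Qed.

Let f_inj : injective f.
Proof. exact: bij_inj (C_iso_bij fC). Qed.

Lemma sd_lamE (x a : T) : lam x a = (alpha x.2 a.1, lam x.2 a.2).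
Proof.
case: x a => [x1 x2] [a1 a2]; congr (_, _) => /=.
by rewrite trivAp addKr.
Qed.

(** Both failures, a_1 = 0 and q | a_2, are inherited by the orbit of a and
    by everything that it generates. *)
Lemma cycle_base_components a : (exists2 S, transitive_cycle_base S & a \in S) ->
  a.1 <> 0 /\ f a.2 \is a GRing.unit.
Proof.
move=> tcb; split=> [a1|].
  have c1 : forall c : T, c.1 = 0.
    apply: (cycle_base_ind tcb) => // c x c1.
    by rewrite sd_lamE /= c1 a1 add_act0 addr0.
  have: (#|Ap| <= 1)%N.
    apply/card_le1P=> x _ y; rewrite !inE.
    by rewrite -[x]/((x, 0) : T).1 -[y]/((y, 0) : T).1 !c1 eqxx.
  by rewrite cardAp leqNgt prime_gt1.
apply: prime_unitZ => //; apply/negP=> qa.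
have qc : forall c : T, f c.2 = 0 %[mod q].
  have qN : (q %| q ^ n)%N by apply: dvdn_exp.
  apply: (cycle_base_ind tcb) => [|c x c0]; first by rewrite (C_iso0 fC).
  rewrite sd_lamE /= (C_isoD fC) (C_iso_lam fC) Zp_modD // -modnDml c0.
  by rewrite mod0n add0n Zp_modM // -modnMmr (eqP qa) muln0 mod0n.
have [h _ hK] := C_iso_bij fC.
have := qc (0, h 1); rewrite /= hK -[1]/(1%:R) Zp_mod_nat ?dvdn_exp //.
by rewrite mod0n modn_small ?prime_gt1.
Qed.

(** The automorphism preserves A_p x 0, the set of elements killed by p, so it
    acts on the second components, as the multiplication by some v. *)
Lemma iso_congr a b (psi : T -> T) (z : T) : bijective psi ->
  {morph psi : x y / x + y} -> {morph psi : x y / circ x y} ->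
  psi a = lam z b -> f a.2 = f b.2 %[mod q ^ minn (n - t) t].
Proof.
move=> [phi _ phiK] psiD psiM psia.
have sndD (x y : T) : (x + y).2 = x.2 + y.2 by [].
have psi0 : psi 0 = 0 by apply: (addIr (psi 0)); rewrite -psiD !add0r.
have psiMn x k : psi (x *+ k) = psi x *+ k.
  by elim: k => [|k IH]; rewrite ?mulr0n ?psi0 // !mulrS psiD IH.
have pairMn x k : ((x, 0) : T) *+ k = (x *+ k, 0).
  by elim: k => // k IH; rewrite !mulrS IH; congr (_, _); rewrite /= addr0.
have sndMn (x : T) k : (x *+ k).2 = x.2 *+ k.
  by elim: k => // k IH; rewrite !mulrS -IH.
have psi10 x : (psi (x, 0)).2 = 0.
  (* This component is killed by p and by q^n. *)
  have pw : (psi (x, 0)).2 *+ p = 0.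
    by rewrite -sndMn -psiMn pairMn -cardAp addr_card psi0.
  apply: f_inj; rewrite (C_iso0 fC).
  have := congr1 f pw; rewrite (C_isoMn fC) (C_iso0 fC) -mulr_natr.
  move/(canRL (mulrK _)); rewrite mul0r; apply.
  rewrite unitZpE // coprimeXl // prime_coprime // dvdn_prime2 //.
  by apply/eqP=> /esym.
pose g y := (psi (0, y)).2.
have psi2 (x : T) : (psi x).2 = g x.2.
  case: x => x y; have -> : (x, y) = (x, 0) + (0, y) :> T.
    by congr (_, _); rewrite /= ?addr0 ?add0r.
  by rewrite psiD sndD psi10 add0r /= add0r.
have gD : {morph g : x y / x + y}.
  move=> x y; rewrite /g -sndD -psiD; congr (psi (_, _)).2.
  by rewrite addr0.
have gM : {morph g : x y / circ x y}.
  move=> x y; rewrite -[LHS](psi2 (circ ((0, x) : T) (0, y))) psiM /=.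
  by rewrite !psi2.
have [h fK hK] := C_iso_bij fC.
have gMn y k : g (y *+ k) = g y *+ k.
  elim: k => [|k IH]; first by rewrite !mulr0n -[LHS](psi2 0) psi0.
  by rewrite !mulrS gD IH.
pose v := f (g (h 1)).
have fg y : f (g y) = v * f y.
  have {1}-> : y = h 1 *+ f y.
    by apply: f_inj; rewrite (C_isoMn fC) hK natr_Zp.
  by rewrite gMn (C_isoMn fC) -/v -mulr_natr natr_Zp.
have v_unit : v \is a GRing.unit.
  have: v * f (phi (0, h 1)).2 = 1 by rewrite -fg -psi2 phiK hK.
  by move=> e; apply/unitrP; exists (f (phi (0, h 1)).2); rewrite mulrC e.
have vE : (q ^ t)%:R * (v - 1) = 0 :> 'Z_(q ^ n).
  have := congr1 f (gM (h 1) (h 1)).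
  rewrite fg !(C_isoM fC) /C_circ fg hK !mulr1 !mulrDr mulr1 => /addrI.
  rewrite mulrN mulr1 => e; apply/eqP; rewrite subr_eq0; apply/eqP.
  by apply: (mulrI v_unit); rewrite e [RHS]mulrC [v * _]mulrC.
have [c cE] := Zp_annihilator q_pr n_gt0 (ltnW lt_tn) vE.
have := congr1 (fun w : T => f w.2) psia.
rewrite psi2 fg sd_lamE /= (C_iso_lam fC) => main.
have zN : (q ^ minn (n - t) t %| q ^ n)%N.
  by rewrite dvdn_exp2l // geq_min leq_subr.
apply/(Zp_eqmodP N1 zN).
have [mt mnt] : (minn (n - t) t <= t)%N /\ (minn (n - t) t <= n - t)%N.
  by rewrite !geq_min !leqnn orbT.
exists ((q ^ (t - minn (n - t) t))%:R * f z.2 * f b.2 -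
  (q ^ (n - t - minn (n - t) t))%:R * c * f a.2).
rewrite mulrBr !mulrA -!natrM -!expnD !subnKC // -cE mulrBl mul1r main.
by rewrite mulrDl mul1r opprB addrA addrC subrK.
Qed.

(** The automorphism is (x, y) |-> (j x, v y); the sought lam-translate of b is
    (alpha_(z2)(b_1), v a_2), and j is chosen to fit its first component. *)
Lemma congr_iso a b :
  cyclic [set: mulgroup Aq] -> (forall y x, alpha (mulpow y q) x = x) ->
  a.1 <> 0 -> b.1 <> 0 -> f a.2 \is a GRing.unit -> f b.2 \is a GRing.unit ->
  f a.2 = f b.2 %[mod q ^ minn (n - t) t] ->
  exists psi : T -> T, exists z, [/\ bijective psi, {morph psi : x y / x + y},
    {morph psi : x y / circ x y} & psi a = lam z b].
Proof.
move=> cycA alphaq a1 b1 a2 b2 ab.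
have [h fK hK] := C_iso_bij fC.
(* Either z2 = 0 or v = 1, according to which of q^(n-t) and q^t is smaller. *)
have [v [z2 [c vE vab]]] : exists v z2,
   exists2 c, v = 1 + (q ^ (n - t))%:R * c & v * f a.2 = f (lam z2 b.2).
  have zN : (q ^ minn (n - t) t %| q ^ n)%N.
    by rewrite dvdn_exp2l // geq_min leq_subr.
  have [d dE] := iffLR (Zp_eqmodP N1 zN _ _) ab.
  have [le|le] := leqP (n - t) t.
    exists (f b.2 / f a.2), 0, (- d / f a.2); last by rewrite divrK // lam0l.
    rewrite (minn_idPl le) in dE.
    rewrite mulrA mulrN -[X in X + _](divrr a2) -mulrDl.
    by congr (_ / _); rewrite dE addrK.
  exists 1, (h (d / f b.2)), 0; first by rewrite mulr0 addr0.
  rewrite (minn_idPr (ltnW le)) in dE.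
  by rewrite mul1r (C_iso_lam fC) hK mulrDl mul1r -!mulrA mulVr // mulr1.
have t0 := C_iso_t_gt0 q_pr n_gt0 fC.
have qN : (q %| q ^ n)%N by apply: dvdn_exp.
have v1 x : (v * x)%R = x %[mod q].
  apply/(Zp_eqmodP N1 qN); exists ((q ^ (n - t).-1)%:R * c * x).
  by rewrite !mulrA -natrM -expnS prednK ?subn_gt0 // vE mulrDl mul1r.
have v_unit : v \is a GRing.unit.
  apply: prime_unitZ => //; rewrite /dvdn -[v]mulr1 v1 -[1]/(1%:R) Zp_mod_nat //.
  by rewrite modn_small ?prime_gt1.
have qtv : (q ^ t)%:R * v = (q ^ t)%:R.
  rewrite vE mulrDr mulr1 mulrA -natrM -expnD subnKC ?(ltnW lt_tn) //.
  have -> : (q ^ n)%:R = 0 :> 'Z_(q ^ n) by apply: pchar_Zp.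
  by rewrite mul0r addr0.
have az0 : alpha z2 b.1 != 0.
  apply/eqP=> e; apply: b1; apply: (bij_inj (add_act_bij alpha z2)).
  by rewrite e add_act0.
have [j [k [aj jk]]] := prime_order_multiple p_pr cardAp (introN eqP a1) az0.
pose m y := h (v * f y).
have fm y : f (m y) = v * f y by rewrite /m hK.
have alm x y : alpha (m y) x = alpha y x.
  by apply: (add_act_residue q_pr n_gt0 fC cycA alphaq); rewrite fm v1.
have alMn x y i : alpha y (x *+ i) = alpha y x *+ i.
  by elim: i => [|i IH]; rewrite ?mulr0n ?add_act0 // !mulrS add_actD IH.
exists (fun x => (x.1 *+ j, m x.2)), (0, z2); split.
- exists (fun x => (x.1 *+ k, h (v^-1 * f x.2))) => -[x y] /=; congr (_, _).
  + exact: jk.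
  + by rewrite fm mulKr.
  + by rewrite mulrnAC jk.
  + by rewrite /m hK mulVKr.
- move=> x y; congr (_, _); first exact: mulrnDl.
  by apply: f_inj; rewrite (C_isoD fC) !fm (C_isoD fC) mulrDr.
- move=> x y; congr (_, _); rewrite /=.
    by rewrite !trivAp mulrnDl alMn alm.
  apply: f_inj; rewrite (C_isoM fC) !fm (C_isoM fC) /C_circ !mulrDr.
  by congr (_ + _); rewrite ((mulrA _ v) (f x.2)) qtv [RHS]mulrCA.
- rewrite sd_lamE; congr (_, _) => /=; first exact: aj.
  by rewrite /m vab fK.
Qed.

End SemidirectIsomorphism.

Theorem corollary4p7 (n p q t : nat) (Ap Aq : finLeftBraceType)
  (alpha : add_action Aq Ap) (trivAp : trivial_brace Ap)
  (a b : brace_sdprod (trivial_compatible alpha trivAp)) :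
  0 < n -> prime p -> prime q -> p <> q -> q < p -> (q, n) <> (2, 2) ->
  #|Ap| = p ->
  ~ trivial_brace Aq -> cyclic [set: mulgroup Aq] -> #|Aq| = q ^ n ->
  type_c_group p q n [set: mulgroup (brace_sdprod (trivial_compatible alpha trivAp))] ->
  (exists2 S, transitive_cycle_base S & a \in S) ->
  (exists2 S, transitive_cycle_base S & b \in S) ->
  #|socle Aq| = q ^ t ->
  sol_isomorphic (brace_solution a) (brace_solution b) <->
  C_congr q n t (q ^ minn (n - t) t) a.2 b.2.
Proof.
move=> n_gt0 p_pr q_pr neq_pq _ qn2 cardAp ntA cycA cardAq typeT.
move=> tcb_a tcb_b cardS.
have [lt_tn [f fC]] := cocyclic_brace_C_iso q_pr n_gt0 cardAq qn2 cycA ntA cardS.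
have N1 : 1 < q ^ n by rewrite -(expn0 q) ltn_exp2l // prime_gt1.
have zN : q ^ minn (n - t) t %| q ^ n.
  by rewrite dvdn_exp2l // geq_min leq_subr.
apply: iff_trans (brace_solution_isoP b tcb_a) _.
apply: iff_trans (iff_sym (C_congrP a.2 b.2 N1 zN fC)).
have [a1 a2] := cycle_base_components p_pr q_pr n_gt0 cardAp fC tcb_a.
have [b1 b2] := cycle_base_components p_pr q_pr n_gt0 cardAp fC tcb_b.
split=> [[psi [z [psi_bij psiD psiM psia]]]|].
  by apply: (iso_congr p_pr q_pr neq_pq n_gt0 lt_tn cardAp fC psi_bij psiD psiM);
    exact: psia.
have alphaq := add_act_expq cardAp cardAq typeT.
exact: (congr_iso p_pr q_pr n_gt0 lt_tn cardAp fC cycA alphaq a1 b1 a2 b2).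
Qed.
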